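(* For every integer $m\ge 0$, $$B(t_m)=\frac{m}{22}\bigl(10t_{m}+5t_{m-1}+3t_{m-2}\bigr)+\frac{1}{22}\bigl(-23t_{m}+12t_{m-1}-5t_{m-2}\bigr)+m+\frac{3}{2}.$$
   Context: The Tribonacci sequence $\mathbb{T}$ is the infinite word over $\{a,b,c\}$ that is the fixed point beginning with $a$ of the morphism $\tau(a)=ab$, $\tau(b)=ac$, $\tau(c)=a$; positions are numbered from $1$, and $\mathbb{T}[1,n]$ is its prefix of length $n$. The numbers $t_m$ are given by $t_{-2}=0$, $t_{-1}=t_0=1$, $t_m=t_{m-1}+t_{m-2}+t_{m-3}$ for $m\ge 1$. $\mathcal{P}_T$ is the set of nonempty palindromes occurring as factors (finite contiguous subwords) of $\mathbb{T}$. For a factor $\omega$ of $\mathbb{T}$ and $p\ge1$, $\omega_p$ denotes the $p$-th occurrence of $\omega$ in $\mathbb{T}$ (every factor occurs infinitely often; occurrences may overlap and are ordered by position). $B(n)$ is the number of pairs $(\omega,p)$ with $\omega\in\mathcal{P}_T$, $p\ge1$, such that the occurrence $\omega_p$ lies entirely inside $\mathbb{T}[1,n]$. *)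

(* Defs.v *)
From HB Require Import structures.
From mathcomp Require Import all_boot all_order all_algebra finmap.
From mathcomp Require Import classical_sets functions cardinality.
Import GRing.Theory.
Set Implicit Arguments. Unset Strict Implicit. Unset Printing Implicit Defensive.

Inductive letter := La | Lb | Lc.

Definition letter_code (x : letter) : 'I_3 :=
  match x with
  | La => @Ordinal 3 0 isT
  | Lb => @Ordinal 3 1 isT
  | Lc => @Ordinal 3 2 isT
  end.
Definition letter_decode (i : 'I_3) : letter :=
  match val i with 0 => La | 1 => Lb | _ => Lc end.
Lemma letter_codeK : cancel letter_code letter_decode.
Proof. by case. Qed.

HB.instance Definition _ := Countable.copy letter (can_type letter_codeK).
HB.instance Definition _ : isFinite letter := CanIsFinite letter_codeK.

Definition tau1 (x : letter) : seq letter :=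
  match x with La => [:: La; Lb] | Lb => [:: La; Lc] | Lc => [:: La] end.

Definition tau (w : seq letter) : seq letter := flatten [seq tau1 x | x <- w].

(* An infinite word is a function on nat: its letter at position i + 1 is u i. *)
Definition wprefix (u : nat -> letter) (n : nat) : seq letter := mkseq u n.

(* Since tau is non-erasing, tau u = u for an infinite word u means that the
   image of every prefix of u is again a prefix of u. *)
Definition tau_fixed (u : nat -> letter) : Prop :=
  forall n, tau (wprefix u n) = wprefix u (size (tau (wprefix u n))).

(* The limit of the words tau^n(a), each of which is a prefix of the next one
   and has length at least n + 1; tribW_unique below shows that it is the only
   fixed point of tau beginning with a. *)
Definition tribW (i : nat) : letter := nth La (iter i tau [:: La]) i.

Lemma tau_cat v w : tau (v ++ w) = tau v ++ tau w.
Proof. by rewrite /tau map_cat flatten_cat. Qed.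

Lemma size_tau w : size w <= size (tau w).
Proof.
elim: w => [//|x w IH]; rewrite -cat1s tau_cat !size_cat.
by apply: leq_add => //; case: x.
Qed.

Lemma tau_iter_prefix n :
  exists2 v, v != [::] & iter n.+1 tau [:: La] = iter n tau [:: La] ++ v.
Proof.
elim: n => [|n [v v0 IH]]; first by exists [:: Lb].
exists (tau v); last by rewrite [in LHS]iterS {1}IH tau_cat.
by rewrite -size_eq0 -lt0n (leq_trans _ (size_tau v)) // lt0n size_eq0.
Qed.

Lemma size_tau_iter n : n < size (iter n tau [:: La]).
Proof.
elim: n => [//|n IH]; have [v v0 ->] := tau_iter_prefix n.
by rewrite size_cat -[n.+2]addn1 leq_add // lt0n size_eq0.
Qed.

Lemma nth_tau_iter n i : i < size (iter n tau [:: La]) ->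
  nth La (iter n tau [:: La]) i = tribW i.
Proof.
have mono k m : i < size (iter m tau [:: La]) ->
    nth La (iter (k + m) tau [:: La]) i = nth La (iter m tau [:: La]) i
    /\ i < size (iter (k + m) tau [:: La]).
  move=> im; elim: k => [//|k [IH1 IH2]]; rewrite addSn.
  have [v _ ->] := tau_iter_prefix (k + m).
  by rewrite nth_cat IH2 size_cat ltn_addr.
move=> isz; rewrite /tribW; case: (leqP n i) => h.
  by have [+ _] := mono (i - n) n isz; rewrite subnK.
by have [+ _] := mono (n - i) i (size_tau_iter i); rewrite subnK // ltnW.
Qed.

Lemma tau_iter_wprefix n :
  iter n tau [:: La] = wprefix tribW (size (iter n tau [:: La])).
Proof.
apply: (@eq_from_nth _ La); first by rewrite size_mkseq.
by move=> i h; rewrite nth_mkseq // nth_tau_iter.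
Qed.

Lemma wprefix_take u m n : n <= m -> wprefix u n = take n (wprefix u m).
Proof. by move=> h; rewrite /wprefix /mkseq -map_take take_iota (minn_idPl h). Qed.

Lemma tribW0 : tribW 0 = La. Proof. by []. Qed.

Lemma tribW_fixed : tau_fixed tribW.
Proof.
move=> n; have h := ltnW (size_tau_iter n).
have E : iter n tau [:: La] =
    wprefix tribW n ++ drop n (iter n tau [:: La]).
  by rewrite {1}(wprefix_take _ h) -tau_iter_wprefix cat_take_drop.
have S : size (tau (wprefix tribW n)) <= size (iter n.+1 tau [:: La]).
  by rewrite iterS [in X in _ <= X]E tau_cat size_cat leq_addr.
rewrite [RHS](wprefix_take _ S) -tau_iter_wprefix iterS [in RHS]E tau_cat.
by rewrite take_size_cat.
Qed.

Lemma tribW_unique u : u 0 = La -> tau_fixed u -> u =1 tribW.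
Proof.
move=> u0 uf i.
have E n : iter n tau [:: La] = wprefix u (size (iter n tau [:: La])).
  elim: n => [|n IH]; first by rewrite /wprefix /= /mkseq /= u0.
  by rewrite iterS {1 2}IH; exact: uf.
by rewrite /tribW E nth_mkseq // size_tau_iter.
Qed.

(* w occupies the positions i + 1, ..., i + size w of the Tribonacci word *)
Definition occurs (w : seq letter) (i : nat) : bool :=
  w == mkseq (fun k => tribW (i + k)) (size w).

Definition pth_occurrence (w : seq letter) (p i : nat) : bool :=
  occurs w i && (count (occurs w) (iota 0 i.+1) == p).

Local Open Scope classical_set_scope.

Definition palT : set (seq letter) :=
  [set w | [/\ w <> [::], rev w = w & exists i, occurs w i]].

Definition pal_occ_in (n : nat) : set (seq letter * nat) :=
  [set wp | [/\ palT wp.1, 0 < wp.2 &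
     exists2 i, pth_occurrence wp.1 wp.2 i & i + size wp.1 <= n]].

(* fset_set A has junk value fset0 on infinite A; see pal_occ_in_finite *)
Definition B (n : nat) : nat := #|` fset_set (pal_occ_in n) |.

Lemma pal_occ_in_finite n : finite_set (pal_occ_in n).
Proof.
pose f (x : {k : 'I_n.+1 & k.-tuple letter} * 'I_n.+1) :=
  (val (tagged x.1), val x.2).
have : finite_set (f @` [set: _]) by apply/finite_image/finite_finset.
apply: sub_finite_set => -[w p] [/= [w0 _ _] p0 [i /andP[_ /eqP cp] iw]].
have sw : size w < n.+1 by rewrite ltnS (leq_trans (leq_addl _ _) iw).
have pn : p < n.+1.
  rewrite ltnS -cp (leq_trans (count_size _ _)) // size_iota.
  rewrite (leq_trans _ iw) // -addn1 leq_add2l lt0n size_eq0.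
  exact/eqP.
by exists (Tagged (fun k : 'I_n.+1 => k.-tuple letter)
            (in_tuple w : (Ordinal sw).-tuple letter), Ordinal pn).
Qed.

Local Close Scope classical_set_scope.

Fixpoint trib (k : nat) : nat :=
  match k with
  | 0 => 0
  | k1.+1 => match k1 with
    | 0 => 1
    | k2.+1 => match k2 with
      | 0 => 1
      | k3.+1 => trib k1 + trib k2 + trib k3
      end
    end
  end.

Local Open Scope ring_scope.

(* t_z for z >= -2, with junk value 0 for z < -2 *)
Definition t (z : int) : nat :=
  match (z + 2)%R with Posz k => trib k | Negz _ => 0%N end.

Lemma t_m2 : t (-2) = 0%N. Proof. by []. Qed.
Lemma t_m1 : t (-1) = 1%N. Proof. by []. Qed.
Lemma t_0 : t 0 = 1%N. Proof. by []. Qed.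
Lemma t_rec (m : int) : 1 <= m -> t m = (t (m - 1) + t (m - 2) + t (m - 3))%N.
Proof.
case: m => [[//|m]|//] _; rewrite /t.
have -> : m.+1%:Z + 2 = m.+3 by rewrite -PoszD addn2.
have -> : m.+1%:Z - 1 + 2 = m.+2 by rewrite -addrA -[_ + 2]/(1%:Z) -PoszD addn1.
have -> : m.+1%:Z - 2 + 2 = m.+1 by rewrite subrK.
have -> // : m.+1%:Z - 3 + 2 = m.
by rewrite -addrA -[- 3 + 2]/(- 1%:Z) -addn1 PoszD addrK.
Qed.

(* Main.v *)
Require Import Defs.
From mathcomp Require Import all_boot all_order all_algebra finmap.
From mathcomp Require Import classical_sets cardinality.
From mathcomp Require Import ring zify.
Import Order.TTheory GRing.Theory Num.Theory.

(* The map w |-> tau(w)a is injective and commutes with reversal, so it maps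
   palindromes to palindromes.  A palindrome of the form a...a inside an image
   under tau is tau(w)a for a palindrome w, and one of the form b...b (c...c) is
   tau(w)a without its two outer letters, for a palindrome w of the form a...a
   (b...b).  Let W_m = tau^m(a), a prefix of length t_m, and let s_m be the
   number of its nonempty palindromic suffixes.  Classifying the palindromes in
   W_(m+1) by their end letters gives
     B(t_(m+1)) = (B(t_m) + t_m - s_m) + (B(t_(m-1)) + t_(m-1) - s_(m-1))
                  + (B(t_(m-2)) + t_(m-2) - s_(m-2)),
   where s_m = 2 floor(m/3) + 1, hence s_m + s_(m-1) + s_(m-2) = 2m - 1.  The
   closed form solves the resulting linear recurrence. *)

Local Open Scope nat_scope.

(** * Palindromes and palindromic suffixes under [tau] *)

Definition palindrome (w : seq letter) : bool := rev w == w.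

Fixpoint npalsuf (w : seq letter) : nat :=
  if w is _ :: w' then palindrome w + npalsuf w' else 0.

Lemma palindrome_cons_rcons x y w :
  palindrome (x :: rcons w y) = (x == y) && palindrome w.
Proof.
rewrite /palindrome rev_cons rev_rcons rcons_cons eqseq_cons eqseq_rcons.
by rewrite eq_sym andbC -andbA; case: (x == y); rewrite ?andbT ?andbF.
Qed.

Lemma tau_cons x w : tau (x :: w) = tau1 x ++ tau w.
Proof. by []. Qed.

Lemma tau_rcons_head w : exists w', rcons (tau w) La = La :: w'.
Proof. by case: w => [|[] w]; eexists. Qed.

(** Every block [tau1 x] starts with [La], so the letter after the leading [La] (b, c or a)
    determines [x]; the appended [La] supplies that letter when [x] is a final [Lc]. *)
Lemma tau_rcons_inj : injective (fun w => rcons (tau w) La).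
Proof.
elim=> [|x v IH] [|y w]; rewrite ?tau_cons ?rcons_cat //.
- by have [w' ->] := tau_rcons_head w; case: y.
- by have [v' ->] := tau_rcons_head v; case: x.
have [v' Ev] := tau_rcons_head v; have [w' Ew] := tau_rcons_head w.
rewrite Ev Ew; case: x; case: y => //= -[] // E;
  by congr (_ :: _); apply: IH; rewrite Ev Ew E.
Qed.

(** For each letter [x], [tau1 x] followed by [La] is a palindrome. *)
Lemma rev_tau w : rev (rcons (tau w) La) = rcons (tau (rev w)) La.
Proof.
elim: w => [//|x w IH].
rewrite tau_cons rcons_cat rev_cat IH rev_cons -[rcons (rev w) x]cats1 tau_cat.
rewrite -!cats1 -!catA.
by congr (_ ++ _); case: x.
Qed.

Lemma palindrome_tau w : palindrome (rcons (tau w) La) = palindrome w.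
Proof. by rewrite /palindrome rev_tau (inj_eq tau_rcons_inj). Qed.

(** A suffix starting inside a block begins with b or c but ends in a, so only tau(v)a for
    palindromic suffixes v of w, and the final [La] alone, count. *)
Lemma npalsuf_tau_a w : npalsuf (rcons (tau w) La) = (npalsuf w).+1.
Proof.
elim: w => [//|x w IH].
have := palindrome_tau (x :: w).
rewrite tau_cons rcons_cat.
by case: x => /= ->; rewrite ?palindrome_cons_rcons IH ?add0n addnS.
Qed.

Lemma tau_rcons w x :
  let v := rcons (tau w) La in
  tau (rcons w x) =
  match x with La => rcons v Lb | Lb => rcons v Lc | Lc => v end.
Proof.
rewrite -[rcons w x]cats1 tau_cat.
by case: x; rewrite /= -!cats1 -?catA.
Qed.

(** Stripping the two outer letters of tau(v)a turns a palindromic suffix v of wy into one of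
    tau(wy), and all arise so. A final c is excluded: its block has no second letter. *)
Lemma npalsuf_tau_last y w : y != Lc ->
  npalsuf (tau (rcons w y)) = npalsuf (rcons w y).
Proof.
move=> yc; elim: w => [|x w IH]; first by case: y yc.
have E : tau (rcons w y) = rcons (rcons (tau w) La) (last La (tau1 y)).
  by rewrite tau_rcons; case: y yc {IH}.
rewrite rcons_cons tau_cons [RHS]/= palindrome_cons_rcons -IH E.
have P z u v :
    palindrome [:: La, u & rcons v z] = (La == z) && palindrome (u :: v).
  by rewrite -rcons_cons palindrome_cons_rcons.
by case: y yc {IH E} => // _; case: x;
  rewrite /= ?P !palindrome_cons_rcons ?palindrome_tau.
Qed.

(* Counts the palindromic occurrences in w, by right end, whose last (hence
   first) letter satisfies Q. *)
Definition palsum (Q : pred letter) (w : seq letter) : nat :=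
  \sum_(j < size w | Q (nth La w j)) npalsuf (take j.+1 w).

Lemma palsum_rcons Q w x :
  palsum Q (rcons w x) = palsum Q w + (if Q x then npalsuf (rcons w x) else 0).
Proof.
rewrite /palsum size_rcons big_mkcond big_ord_recr [in RHS]big_mkcond /=.
congr (_ + _).
  apply: eq_bigr => j _; rewrite nth_rcons ltn_ord -cats1.
  by rewrite takel_cat.
by rewrite nth_rcons ltnn eqxx -(size_rcons w x) take_size.
Qed.

(** Each a in tau(w) opens a block; the prefix ending there is tau(u)a for a proper, possibly empty,
    prefix u of w. *)
Lemma palsum_tau_a w :
  palsum (pred1 La) (tau w) + npalsuf w = palsum predT w + size w.
Proof.
elim/last_ind: w => [|w x /= IH]; first by rewrite /palsum !big_ord0.
rewrite size_rcons palsum_rcons tau_rcons.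
by case: x; rewrite !palsum_rcons /= npalsuf_tau_a; lia.
Qed.

Lemma palsum_tau_b w : palsum (pred1 Lb) (tau w) = palsum (pred1 La) w.
Proof.
elim/last_ind: w => [|w x /= IH]; first by rewrite /palsum !big_ord0.
have := @npalsuf_tau_last x w; rewrite palsum_rcons -IH tau_rcons.
by case: x => [/(_ isT)|_|_]; rewrite !palsum_rcons /= ?addn0 // => ->.
Qed.

(** The last two sums come from the right ends b and c, which close the blocks of a and b. *)
Lemma palsum_tau w :
  palsum predT (tau w) + npalsuf w =
  palsum predT w + size w + palsum (pred1 La) w + palsum (pred1 Lb) w.
Proof.
elim/last_ind: w => [|w x /= IH]; first by rewrite /palsum !big_ord0.
have := @npalsuf_tau_last x w; rewrite size_rcons !palsum_rcons tau_rcons.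
by case: x => [/(_ isT)|/(_ isT)|_];
  rewrite !palsum_rcons /= npalsuf_tau_a; lia.
Qed.

(** * The prefixes tau^m(a) *)

Definition tribpref (m : nat) : seq letter := iter m tau [:: La].

Lemma tribprefS m : tribpref m.+1 = tau (tribpref m).
Proof. by []. Qed.

(** Over three steps the last letters run a, b, c, a. The word [v] arises from [w] by two maps u ->
    tau(u)a, each adding one palindromic suffix. *)
Lemma tribpref_3k k :
  exists w, [/\ tribpref (3 * k) = rcons w La, npalsuf w = 2 * k
    & npalsuf (rcons w La) = (2 * k).+1].
Proof.
elim: k => [|k [w [E sw _]]]; first by exists [::].
pose v := rcons (tau (rcons (tau w) La)) La.
exists (tau v); have sv : npalsuf v = 2 * k.+1.
  by rewrite !npalsuf_tau_a sw mulnS.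
split.
- by rewrite mulnS !tribprefS E !tau_rcons.
- by rewrite npalsuf_tau_last.
- by rewrite npalsuf_tau_a sv.
Qed.

Lemma npalsuf_tribpref m : npalsuf (tribpref m) = (2 * (m %/ 3)).+1.
Proof.
have [w [E _ s0]] := tribpref_3k (m %/ 3).
have s1 : npalsuf (tau (rcons w La)) = npalsuf (rcons w La).
  exact: npalsuf_tau_last.
have s2 : npalsuf (tau (tau (rcons w La))) = npalsuf (rcons w La).
  by rewrite -s1 tau_rcons npalsuf_tau_last.
rewrite -s0 {1}(divn_eq m 3) [_ * 3]mulnC addnC.
have := ltn_pmod m (isT : 0 < 3).
by case: (m %% 3) => [|[|[|//]]] _; rewrite ?addSn add0n ?tribprefS E.
Qed.

Lemma count_tribpref m :
  [/\ size (tribpref m) = trib m.+2, count_mem La (tribpref m) = trib m.+1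
    & count_mem Lb (tribpref m) = trib m].
Proof.
have sz w : [/\ size (tau w) = size w + count_mem La w + count_mem Lb w,
    count_mem La (tau w) = size w & count_mem Lb (tau w) = count_mem La w].
  elim: w => [//|x w [IH1 IH2 IH3]].
  rewrite tau_cons size_cat !count_cat IH1 IH2 IH3.
  by split; case: x => /=; lia.
elim: m => [//|m [IH1 IH2 IH3]]; rewrite tribprefS.
have [-> -> ->] := sz (tribpref m).
by rewrite IH1 IH2 IH3.
Qed.

(** Here [2 * m + 3] is s_(m+2) + s_(m+1) + s_m, and [trib m.+4.+1] is t_(m+3), the sum of the three
    lengths. *)
Lemma palsum_tribpref_rec m :
  palsum predT (tribpref m.+3) + (2 * m + 3) =
  palsum predT (tribpref m.+2) + palsum predT (tribpref m.+1)
  + palsum predT (tribpref m) + trib m.+4.+1.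
Proof.
have := palsum_tau (tribpref m.+2).
have := palsum_tau_a (tribpref m.+1).
have := palsum_tau_b (tribpref m.+1).
have := palsum_tau_a (tribpref m).
have [s0 _ _] := count_tribpref m.
have [s1 _ _] := count_tribpref m.+1.
have [s2 _ _] := count_tribpref m.+2.
rewrite -!tribprefS s0 s1 s2 !npalsuf_tribpref.
rewrite -[trib m.+4.+1]/(trib m.+4 + trib m.+3 + trib m.+2).
by lia.
Qed.

(** * Occurrences as intervals of positions *)

Definition factor (i j : nat) : seq letter := drop i (wprefix tribW j).

Lemma factorE i j : factor i j = mkseq (fun k => tribW (i + k)) (j - i).
Proof.
by rewrite /factor /wprefix /mkseq -map_drop drop_iota addnC iotaDl -map_comp.
Qed.

Lemma size_factor i j : size (factor i j) = j - i.
Proof. by rewrite factorE size_mkseq. Qed.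

Lemma occursE w i : occurs w i = (w == factor i (i + size w)).
Proof. by rewrite factorE addKn. Qed.

(** Grouped by right end, to match [palsum]. *)
Definition pal_occ (n : nat) : seq (nat * nat) :=
  [seq (i, j.+1) | j <- iota 0 n,
     i <- [seq i <- iota 0 j.+1 | palindrome (factor i j.+1)]].

Lemma pal_occP n i j : reflect [/\ i < j, j <= n & palindrome (factor i j)]
  ((i, j) \in pal_occ n).
Proof.
apply: (iffP allpairsPdep) => [[j' [i' [+ + [-> ->]]]]|[ij jn p]].
  by rewrite mem_filter !mem_iota => j'n /andP[-> /=]; split.
case: j ij jn p => // j ij jn p.
by exists j, i; rewrite mem_filter !mem_iota p.
Qed.

Lemma uniq_pal_occ n : uniq (pal_occ n).
Proof.
apply: allpairs_uniq_dep; first exact: iota_uniq.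
  by move=> j _; apply: filter_uniq (iota_uniq _ _).
by move=> [j i] [j' i'] _ _ /= [-> ->].
Qed.

Lemma npalsufE w :
  npalsuf w = count (fun i => palindrome (drop i w)) (iota 0 (size w)).
Proof.
by elim: w => [//|x w IH]; rewrite /= IH -[1]addn0 iotaDl count_map.
Qed.

Lemma size_pal_occ n : size (pal_occ n) = palsum predT (wprefix tribW n).
Proof.
rewrite size_allpairs_dep sumnE big_map -{1}[n]subn0 big_mkord.
rewrite /palsum size_mkseq; apply: eq_bigr => j _.
by rewrite -wprefix_take // npalsufE size_mkseq size_filter.
Qed.

Definition pal_occ_rank (x : nat * nat) : seq letter * nat :=
  let w := factor x.1 x.2 in (w, count (occurs w) (iota 0 x.1.+1)).

(** For a fixed word the rank strictly increases with the start, so word and rank determine the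
    start, and the length then gives the end. *)
Lemma pal_occ_rank_inj n : {in pal_occ n &, injective pal_occ_rank}.
Proof.
have lt_rank w i i' : occurs w i' -> i < i' ->
    count (occurs w) (iota 0 i.+1) < count (occurs w) (iota 0 i'.+1).
  move=> oi' ii'; rewrite -[in X in _ < X]addn1 iotaD count_cat /= oi'.
  by rewrite -(subnKC ii') iotaD count_cat addn1 ltnS leq_addr.
have occ i j : i < j -> occurs (factor i j) i.
  by move=> /ltnW ij; rewrite occursE size_factor subnKC.
move=> [i j] [i' j'] /pal_occP[ij _ _] /pal_occP[ij' _ _] EC.
have E : factor i j = factor i' j' := congr1 fst EC.
have C : count (occurs (factor i j)) (iota 0 i.+1) =
    count (occurs (factor i' j')) (iota 0 i'.+1) := congr1 snd EC.
have ii' : i = i'.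
  case: (ltngtP i i') => // h.
    by have := lt_rank _ _ _ (occ _ _ ij') h; rewrite -C E ltnn.
  by have := lt_rank _ _ _ (occ _ _ ij) h; rewrite C E ltnn.
have := congr1 size E; rewrite !size_factor -ii' => S.
by congr (_, _); rewrite // -(subnKC (ltnW ij)) S subnKC // ltnW // ii'.
Qed.

Lemma B_palsum n : B n = palsum predT (wprefix tribW n).
Proof.
rewrite -size_pal_occ -(size_map pal_occ_rank).
have /undup_id <- : uniq (map pal_occ_rank (pal_occ n)).
  by rewrite map_inj_in_uniq ?uniq_pal_occ //; exact: pal_occ_rank_inj.
rewrite -card_fseq /B; congr (size (enum_fset _)); apply/fsetP => -[w p].
rewrite in_fset_set; last exact: pal_occ_in_finite.
rewrite inE; apply/idP/mapP.
  rewrite inE => -[[/eqP w0 /eqP wp _] /= p0 [i /andP[oi /eqP <-] iw]].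
  have E : w = factor i (i + size w) by apply/eqP; rewrite -occursE.
  exists (i, i + size w); last by rewrite /pal_occ_rank /= -E.
  apply/pal_occP; split=> //; last by rewrite -E.
  by rewrite -addn1 leq_add2l lt0n size_eq0.
move=> [[i j] /pal_occP[ij jn pal_ij] [-> ->]]; rewrite inE /=.
have oi : occurs (factor i j) i.
  by rewrite occursE size_factor subnKC // ltnW.
have ci : 0 < count (occurs (factor i j)) (iota 0 i.+1).
  by rewrite -has_count; apply/hasP; exists i; rewrite // mem_iota /= add0n.
split=> //=.
- split; [|exact/eqP|by exists i].
  by move/(congr1 size)/eqP; rewrite size_factor subn_eq0 leqNgt ij.
exists i; first by rewrite /pth_occurrence oi eqxx.
by rewrite size_factor subnKC // ltnW.
Qed.

(** * Recurrence and closed form *)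

Lemma B_rec m :
  B (trib m.+4.+1) + (2 * m + 3) =
  B (trib m.+4) + B (trib m.+3) + B (trib m.+2) + trib m.+4.+1.
Proof.
have Bpref k : B (trib k.+2) = palsum predT (tribpref k).
  by have [<- _ _] := count_tribpref k; rewrite B_palsum -tau_iter_wprefix.
by rewrite !Bpref palsum_tribpref_rec.
Qed.

Lemma B_init : [/\ B 1 = 1, B 2 = 2 & B 4 = 5].
Proof.
by split; rewrite B_palsum /palsum size_mkseq !big_ord_recr big_ord0.
Qed.

Local Open Scope ring_scope.

Theorem theorem7p7 (m : nat) :
  (B (t m%:Z))%:R =
    m%:R / 22 * (10 * (t m%:Z)%:R + 5 * (t (m%:Z - 1))%:R + 3 * (t (m%:Z - 2))%:R)
    + 1 / 22 * (- 23 * (t m%:Z)%:R + 12 * (t (m%:Z - 1))%:R - 5 * (t (m%:Z - 2))%:R)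
    + m%:R + 3 / 2 :> rat.
Proof.
have -> : t m%:Z = trib m.+2 by rewrite /t -PoszD addn2.
have -> : t (m%:Z - 1) = trib m.+1.
  by rewrite /t -addrA -[- 1 + 2]/(1%:Z) -PoszD addn1.
have -> : t (m%:Z - 2) = trib m by rewrite /t subrK.
(* The shifts differ: [T k] is t_(k-2), while [b k] is B(t_k). *)
pose T k : rat := (trib k)%:R; pose b k : rat := (B (trib k.+2))%:R.
rewrite -/(b m) -!/(T _).
have TS k : T k.+3 = T k.+2 + T k.+1 + T k by rewrite /T -!natrD.
have bS k : b k.+3 = b k.+2 + b k.+1 + b k + T k.+4.+1 - (2 * k%:R + 3).
  by apply: (canRL (addrK _)); rewrite /b /T -natrM -!natrD B_rec.
have [b0 b1 b2] : [/\ b 0 = 1, b 1 = 2 & b 2 = 5].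
  by rewrite /b; have [-> -> ->] := B_init.
have [T0 T1 T2] : [/\ T 0 = 0, T 1 = 1 & T 2 = 1] by [].
clearbody T b; elim/ltn_ind: m => -[_|[_|[_|m IH]]].
- by rewrite b0 T0 T1 T2; field.
- by rewrite b1 !TS T0 T1 T2; field.
- by rewrite b2 !TS T0 T1 T2; field.
rewrite bS (IH m.+2) // (IH m.+1) // ?(IH m) //; last by rewrite ltnS leqW.
(* With [m%:R], [T m], [T m.+1] and [T m.+2] as the only atoms, the goal is a polynomial
   identity. *)
rewrite !TS; have -> : m.+3%:R = m%:R + 3 :> rat by rewrite -natrD addn3.
have -> : m.+2%:R = m%:R + 2 :> rat by rewrite -natrD addn2.
have -> : m.+1%:R = m%:R + 1 :> rat by rewrite natr1.
by field.
Qed.
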